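(* Consider a smooth deterministic function-constrained variational inequality and let $\{(x^t,\lambda^t)\}$ be generated by the Adaptive Operator Extrapolation method (both described in the context). Let $c_1,c_2,\beta>0$ satisfy $$\tfrac{c_1}{3}\ \ge\ \tfrac{c_1}{c_2}+1,\qquad \beta=\frac{12M_g^2}{c_1^2L^2},$$ and let the parameters be, for $t\ge 0$, $$\eta_t=c_1L+c_2L_g\max_{1\le i\le t}\|\lambda^i\|,\qquad \gamma_t=\frac{\eta_0}{\eta_t},\qquad \theta_t=\frac{\gamma_{t-1}}{\gamma_t},\qquad \tau_t=\beta\eta_t$$ (the maximum over the empty set, for $t=0$, being $0$). Then $$\|\lambda^{t+1}\|\le B:=\sqrt{\tfrac{2}{\beta}}\,\|x^0-x^*\|+(\sqrt2+1)\|\lambda^*\|\qquad\text{for all }t\ge 0,$$ $$\Gamma_T\,\langle F(x),\bar x^T-x\rangle\le \frac{c_1L}{2}\|x-x^0\|^2\qquad\text{for all }x\in\widetilde X,$$ $$\Gamma_T\,\|[g(\bar x^T)]_+\|\le \frac{c_1L}{2}\|x^*-x^0\|^2+\frac{\beta c_1L}{2}(\|\lambda^*\|+1)^2,$$ while $$\Gamma_T\ge \frac{c_1L}{c_1L+c_2L_gB}\,T .$$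
   Context: Setting (smooth deterministic FCVI). $\|\cdot\|$ is the Euclidean norm. $X\subset\mathbb R^n$ is a convex compact set, $F:X\to\mathbb R^n$ is monotone, i.e. $\langle F(x_1)-F(x_2),x_1-x_2\rangle\ge0$ on $X$, and $L$-Lipschitz: $\|F(x_1)-F(x_2)\|\le L\|x_1-x_2\|$. The functions $g_j:X\to\mathbb R$, $j=1,\dots,m$, are convex and differentiable; $g_j$ is $M_{g_j}$-Lipschitz with $\|\nabla g_j(x)\|\le M_{g_j}$, and $\nabla g_j$ is $L_{g_j}$-Lipschitz. Put $g=(g_1,\dots,g_m)^T$, $\nabla g(x)=[\nabla g_1(x),\dots,\nabla g_m(x)]\in\mathbb R^{n\times m}$, $M_g=(\sum_jM_{g_j}^2)^{1/2}$, $L_g=(\sum_jL_{g_j}^2)^{1/2}$, $\widetilde X=X\cap\{x:g(x)\le\mathbf 0\}$; $[\cdot]_+$ is the componentwise positive part. The constants $L, M_g$ are positive. The FCVI asks for $x^*\in\widetilde X$ with $\langle F(x^* ),x-x^*\rangle\ge0$ for all $x\in\widetilde X$. Standing assumption: there exist a solution $x^*$ and $\lambda^*\in\mathbb R^m_+$ with $\mathbf 0\in F(x^* )+\sum_j\lambda_j^*\nabla g_j(x^* )+N_X(x^* )$ and $\lambda^*_jg_j(x^* )=0$ for all $j$, where $N_X(x^* )=\{v:\langle v,\tilde x-x^*\rangle\le0\ \forall\tilde x\in X\}$. Adaptive Operator Extrapolation method. Input $x^0\in X$, $\lambda^0=\mathbf 0$; set $x^{-1}=x^0$, $\lambda^{-1}=\lambda^0$.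 For $t=0,1,2,\dots$: $s^t=(1+\theta_t)g(x^t)-\theta_tg(x^{t-1})$; $\lambda^{t+1}=\arg\min_{\lambda\ge\mathbf 0}\langle -s^t,\lambda\rangle+\frac{\tau_t}{2}\|\lambda-\lambda^t\|^2$; $u^t=(1+\theta_t)[F(x^t)+\nabla g(x^t)\lambda^t]-\theta_t[F(x^{t-1})+\nabla g(x^{t-1})\lambda^{t-1}]$; $x^{t+1}=\arg\min_{x\in X}\langle u^t,x\rangle+\frac{\eta_t}{2}\|x-x^t\|^2$. The value of $\theta_0$ has no effect, so $\gamma_{-1}$ may be chosen arbitrarily. The output after $T$ iterations is $\bar x^T=\frac1{\Gamma_T}\sum_{t=0}^{T-1}\gamma_tx^{t+1}$, with $\Gamma_T=\sum_{t=0}^{T-1}\gamma_t$. *)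

(* Defs.v *)
From HB Require Import structures.
From mathcomp Require Import all_boot all_order all_algebra.
From mathcomp Require Import all_classical all_reals all_analysis.

Set Implicit Arguments.
Unset Strict Implicit.
Unset Printing Implicit Defensive.

Import Order.TTheory GRing.Theory Num.Theory.
Import numFieldNormedType.Exports.

Local Open Scope classical_set_scope.
Local Open Scope ring_scope.

Section Euclidean.
Context {R : realType}.

Definition dotp n (u v : 'cV[R]_n) : R := \sum_(i < n) u i 0 * v i 0.

(* The library norm on matrices is the sup norm; the Euclidean norm is needed
   here. The two induce the same topology, so the library's [compact] and [nbhs]
   on column vectors are the usual ones. *)
Definition enorm n (u : 'cV[R]_n) : R := Num.sqrt (dotp u u).

Definition l2norm m (c : 'I_m -> R) : R := Num.sqrt (\sum_(j < m) c j ^+ 2).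

Definition posvec m (v : 'cV[R]_m) : 'cV[R]_m := \col_(j < m) Num.max (v j 0) 0.

Definition nneg_orthant m : set 'cV[R]_m := [set l | forall j, 0 <= l j 0].

Definition argmin (T : Type) (A : set T) (f : T -> R) : set T :=
  [set a | A a /\ forall b, A b -> f a <= f b].

Definition normal_cone n (X : set 'cV[R]_n) (a : 'cV[R]_n) : set 'cV[R]_n :=
  [set v | forall y, X y -> dotp v (y - a) <= 0].

(* A function X -> R is represented by a total function whose values outside X
   are irrelevant; differentiability is therefore relative to X:
   f y = f x + <v, y - x> + o(|y - x|) as y -> x with y in X.
   When X is a neighbourhood of x this is ordinary (Frechet) differentiability
   with gradient v. *)
Definition is_gradient_on n (X : set 'cV[R]_n) (f : 'cV[R]_n -> R)
    (x v : 'cV[R]_n) : Prop :=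
  (fun y => f y - (f x + dotp v (y - x)) : R^o)
    =o_ (within X (nbhs x)) (fun y => enorm (y - x) : R^o).

End Euclidean.

Section FCVI.
Context {R : realType} {n m : nat}.
Implicit Types (X : set 'cV[R]_n) (F : 'cV[R]_n -> 'cV[R]_n).
Implicit Types (g : 'I_m -> 'cV[R]_n -> R) (dg : 'I_m -> 'cV[R]_n -> 'cV[R]_n).

Definition gvec g (x : 'cV[R]_n) : 'cV[R]_m := \col_(j < m) g j x.

Definition gradmx dg (x : 'cV[R]_n) : 'M[R]_(n, m) :=
  \matrix_(i < n, j < m) dg j x i 0.

Definition feasible X g : set 'cV[R]_n := X `&` [set x | forall j, g j x <= 0].

(* [dg j] is the gradient map of [g j] on X. *)
Record smooth_fcvi X F g dg (L : R) (Mgj Lgj : 'I_m -> R) : Prop := {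
  fcvi_convex_X : convex_set X;
  fcvi_compact_X : compact X;
  fcvi_monotone : forall x1 x2, X x1 -> X x2 ->
    0 <= dotp (F x1 - F x2) (x1 - x2);
  fcvi_lipschitz_F : forall x1 x2, X x1 -> X x2 ->
    enorm (F x1 - F x2) <= L * enorm (x1 - x2);
  fcvi_convex_g : forall j, convex_function X (g j);
  fcvi_gradient : forall j x, X x -> is_gradient_on X (g j) x (dg j x);
  fcvi_lipschitz_g : forall j x1 x2, X x1 -> X x2 ->
    `|g j x1 - g j x2| <= Mgj j * enorm (x1 - x2);
  fcvi_bound_dg : forall j x, X x -> enorm (dg j x) <= Mgj j;
  fcvi_lipschitz_dg : forall j x1 x2, X x1 -> X x2 ->
    enorm (dg j x1 - dg j x2) <= Lgj j * enorm (x1 - x2);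
  fcvi_L_gt0 : 0 < L;
  fcvi_Mg_gt0 : 0 < l2norm Mgj
}.

Definition fcvi_solution X F g (xs : 'cV[R]_n) : Prop :=
  feasible X g xs /\ forall x, feasible X g x -> 0 <= dotp (F xs) (x - xs).

Definition kkt_multiplier X F g dg (xs : 'cV[R]_n) (ls : 'cV[R]_m) : Prop :=
  [/\ nneg_orthant ls,
      exists2 v, normal_cone X xs v
        & 0 = F xs + \sum_(j < m) ls j 0 *: dg j xs + v
    & forall j, ls j 0 * g j xs = 0].

(* Since 0.-1 = 0, the index t.-1 encodes x^{-1} = x^0 and lam^{-1} = lam^0. *)
Record adaptive_opex X F g dg (eta theta tau : nat -> R)
    (x : nat -> 'cV[R]_n) (lam : nat -> 'cV[R]_m) : Prop := {
  opex_x0 : X (x 0%N);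
  opex_lam0 : lam 0%N = 0;
  opex_lam : forall t,
    let s := (1 + theta t) *: gvec g (x t) - theta t *: gvec g (x t.-1) in
    argmin (@nneg_orthant R m)
      (fun l => dotp (- s) l + tau t / 2 * enorm (l - lam t) ^+ 2) (lam t.+1);
  opex_x : forall t,
    let u := (1 + theta t) *: (F (x t) + gradmx dg (x t) *m lam t)
             - theta t *: (F (x t.-1) + gradmx dg (x t.-1) *m lam t.-1) in
    argmin X
      (fun y => dotp u y + eta t / 2 * enorm (y - x t) ^+ 2) (x t.+1)
}.

Definition eta_param (c1 c2 L Lg : R) (lam : nat -> 'cV[R]_m) (t : nat) : R :=
  c1 * L + c2 * Lg * \big[Num.max/0]_(1 <= i < t.+1) enorm (lam i).

Definition gamma_param (eta : nat -> R) (t : nat) : R := eta 0%N / eta t.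

(* [gm1] stands for the arbitrary value of gamma_{-1}. *)
Definition theta_param (gm1 : R) (gamma : nat -> R) (t : nat) : R :=
  (if t is s.+1 then gamma s else gm1) / gamma t.

Definition Gamma_sum (gamma : nat -> R) (T : nat) : R := \sum_(t < T) gamma t.

Definition xbar (gamma : nat -> R) (x : nat -> 'cV[R]_n) (T : nat) : 'cV[R]_n :=
  (Gamma_sum gamma T)^-1 *: \sum_(t < T) gamma t *: x t.+1.

End FCVI.

(* Main.v *)
Require Import Defs.
From HB Require Import structures.
From mathcomp Require Import all_boot all_order all_algebra.
From mathcomp Require Import all_classical all_reals all_analysis.
From mathcomp Require Import ring lra.

Set Implicit Arguments.
Unset Strict Implicit.
Unset Printing Implicit Defensive.

Import Order.TTheory GRing.Theory Num.Theory.
Import numFieldNormedType.Exports.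

Local Open Scope classical_set_scope.
Local Open Scope ring_scope.

(** Write [e = c1 L] and let the saddle operator be
    [(x, l) |-> (F x + grad g(x) l, - g x)].  Each iteration is a proximal step
    for the saddle operator extrapolated along its last increment.  The
    three-point inequality of the two proximal steps ([argmin_prox_le]), weighted
    by [gamma t], has the following structure.

    - Since [gamma t * eta t = e] is constant, the squared distances from the
      iterates to a fixed pair [(y, l)] telescope.

    - Since [gamma t * theta t = gamma (t - 1)], the part of the extrapolation
      paired with the distance to [(y, l)] telescopes too
      ([extrapolation_split]).  What remains is the pairing of the last increment
      of the operator with the step just made: a [coupling].

    - The increment of the Lagrangian operator is at most
      [(L + Lg |lam t|) |dx| + Mg |dlam|]; the adaptive [eta t] dominates
      [3 (L + Lg |lam t|)] whatever the size of the multipliers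
      ([gamma_lipschitz]).  With [beta e^2 = 12 Mg^2] the coupling is then at
      most [e / 4] times the weighted squared lengths of the two neighbouring
      steps ([gamma_coupling_le]), and the proximal terms, with coefficient
      [e / 2], pay for both halves.

    Monotonicity of [F] and the gradient inequality for the convex [g j] turn the
    left-hand side into the saddle gap
    [<F y, x - y> + <l, g x> - <lam, g y>], so that for all [y] in [X] and
    [l >= 0] ([sum_gap_le])

      [sum_t gamma t * gap t y l
         <= e/2 (|y - x 0|^2 + beta |l|^2)
            - e/4 (|y - x T|^2 + beta |l - lam T|^2)].

    The conclusions are instances of this estimate.  For [(y, l) = (xs, ls)] the
    gaps are nonnegative and the last term bounds [lam T]; hence [eta] is bounded
    above, and [Gamma_sum] below.  Dropping the last term and applying Jensen's
    inequality bounds the gap at the averaged iterate ([xbar_gap_le]): [l = 0]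
    gives the variational inequality, and [y = xs] with [l] of norm [|ls| + 1]
    along the positive part of [g xbar] gives the constraint violation. *)

(** * Euclidean geometry of column vectors *)

Section EuclideanTheory.
Context {R : realType}.

Section Dot.
Context {n : nat}.
Implicit Types (u v w : 'cV[R]_n) (a : R).

Lemma dotpC u v : dotp u v = dotp v u.
Proof. by apply: eq_bigr => i _; rewrite mulrC. Qed.

Lemma dotpDl u v w : dotp (u + v) w = dotp u w + dotp v w.
Proof. by rewrite -big_split; apply: eq_bigr => i _; rewrite mxE mulrDl. Qed.

Lemma dotpZl a u v : dotp (a *: u) v = a * dotp u v.
Proof. by rewrite mulr_sumr; apply: eq_bigr => i _; rewrite mxE mulrA. Qed.

Lemma dotpNl u v : dotp (- u) v = - dotp u v.
Proof. by rewrite -scaleN1r dotpZl mulN1r. Qed.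

Lemma dotpBl u v w : dotp (u - v) w = dotp u w - dotp v w.
Proof. by rewrite dotpDl dotpNl. Qed.

Lemma dotpDr u v w : dotp u (v + w) = dotp u v + dotp u w.
Proof. by rewrite dotpC dotpDl !(dotpC u). Qed.

Lemma dotpZr a u v : dotp u (a *: v) = a * dotp u v.
Proof. by rewrite dotpC dotpZl dotpC. Qed.

Lemma dotpNr u v : dotp u (- v) = - dotp u v.
Proof. by rewrite dotpC dotpNl dotpC. Qed.

Lemma dotpBr u v w : dotp u (v - w) = dotp u v - dotp u w.
Proof. by rewrite dotpDr dotpNr. Qed.

Lemma dotp0l u : dotp 0 u = 0.
Proof. by rewrite -(scale0r 0) dotpZl mul0r. Qed.

Lemma dotp_suml (I : Type) (r : seq I) (w : I -> 'cV[R]_n) v :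
  dotp (\sum_(i <- r) w i) v = \sum_(i <- r) dotp (w i) v.
Proof.
by elim/big_ind2: _ => [|? ? ? ? <- <-|//]; rewrite ?dotp0l ?dotpDl.
Qed.

Lemma dotp_ge0 u : 0 <= dotp u u.
Proof. by apply: sumr_ge0 => i _; rewrite -expr2 sqr_ge0. Qed.

Lemma enorm_ge0 u : 0 <= enorm u.
Proof. exact: sqrtr_ge0. Qed.

Lemma enorm_sqr u : enorm u ^+ 2 = dotp u u.
Proof. by rewrite sqr_sqrtr ?dotp_ge0. Qed.

Lemma enorm_eq0 u : enorm u = 0 -> u = 0.
Proof.
move=> u0; have := enorm_sqr u; rewrite u0 expr0n /= => /esym/eqP.
rewrite psumr_eq0 => [/allP h|i _]; last by rewrite -expr2 sqr_ge0.
apply/matrixP => i j; rewrite ord1 mxE.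
by have := h i (mem_index_enum _); rewrite mulf_eq0 orbb => /eqP.
Qed.

Lemma enorm0 : enorm (0 : 'cV[R]_n) = 0.
Proof. by rewrite /enorm dotp0l sqrtr0. Qed.

Lemma enormN u : enorm (- u) = enorm u.
Proof. by rewrite /enorm dotpNl dotpNr opprK. Qed.

Lemma enormBC u v : enorm (u - v) = enorm (v - u).
Proof. by rewrite -enormN opprB. Qed.

Lemma enormZ a u : enorm (a *: u) = `|a| * enorm u.
Proof.
by rewrite /enorm dotpZl dotpZr mulrA -expr2 sqrtrM ?sqr_ge0 // sqrtr_sqr.
Qed.

Lemma cauchy_schwarz u v : dotp u v <= enorm u * enorm v.
Proof.
have [/enorm_eq0 ->|u0] := eqVneq (enorm u) 0.
  by rewrite dotp0l enorm0 mul0r.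
have [/enorm_eq0 ->|v0] := eqVneq (enorm v) 0.
  by rewrite dotpC dotp0l enorm0 mulr0.
have up : 0 < enorm u by rewrite lt_def u0 enorm_ge0.
have vp : 0 < enorm v by rewrite lt_def v0 enorm_ge0.
have := dotp_ge0 (enorm v *: u - enorm u *: v).
rewrite dotpBl !dotpBr !dotpZl !dotpZr -!enorm_sqr (dotpC v u).
have uv : 0 < enorm u * enorm v by rewrite mulr_gt0.
rewrite -(ler_pM2l uv (dotp u v)); lra.
Qed.

Lemma enormD u v : enorm (u + v) <= enorm u + enorm v.
Proof.
rewrite -(ler_pXn2r (ltn0Sn 1)) ?nnegrE ?addr_ge0 ?enorm_ge0 //.
rewrite enorm_sqr dotpDl !dotpDr -!enorm_sqr (dotpC v u) sqrrD.
have := cauchy_schwarz u v; lra.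
Qed.

Lemma enorm_sum (I : Type) (r : seq I) (w : I -> 'cV[R]_n) :
  enorm (\sum_(i <- r) w i) <= \sum_(i <- r) enorm (w i).
Proof.
elim/big_ind2: _ => [|u a v b hu hv|//]; first by rewrite enorm0.
by apply: le_trans (enormD _ _) _; exact: lerD.
Qed.

End Dot.

Lemma l2normE m (c : 'I_m -> R) : l2norm c = enorm (\col_j c j).
Proof.
by congr Num.sqrt; apply: eq_bigr => j _; rewrite mxE expr2.
Qed.

Lemma l2norm_ge0 m (c : 'I_m -> R) : 0 <= l2norm c.
Proof. exact: sqrtr_ge0. Qed.

Lemma enorm_le_l2norm m (v : 'cV[R]_m) (c : 'I_m -> R) (k : R) : 0 <= k ->
  (forall j, `|v j 0| <= c j * k) -> enorm v <= l2norm c * k.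
Proof.
move=> k0 hv.
rewrite -(ler_pXn2r (ltn0Sn 1)) ?nnegrE ?mulr_ge0 ?enorm_ge0 ?l2norm_ge0 //.
rewrite exprMn l2normE !enorm_sqr /dotp mulr_suml.
apply: ler_sum => j _; rewrite mxE -!expr2 -exprMn -real_normK ?num_real //.
by apply: lerXn2r; rewrite ?nnegrE // (le_trans _ (hv j)).
Qed.

(** Summing the bounds on the individual vectors and applying the
    Cauchy-Schwarz inequality to the coefficients bounds a combination by the
    Euclidean norms of both families. *)
Lemma enorm_lincomb m n (l : 'cV[R]_m) (w : 'I_m -> 'cV[R]_n) (c : 'I_m -> R)
    (k : R) : 0 <= k ->
  (forall j, enorm (w j) <= c j * k) ->
  enorm (\sum_j l j 0 *: w j) <= l2norm c * enorm l * k.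
Proof.
move=> k0 hw; apply: le_trans (enorm_sum _ _) _.
have -> : enorm l = enorm (\col_j `|l j 0|).
  congr Num.sqrt; apply: eq_bigr => j _.
  by rewrite !mxE -!expr2 real_normK ?num_real.
rewrite l2normE; apply: le_trans (ler_wpM2r k0 (cauchy_schwarz _ _)).
rewrite mulr_suml; apply: ler_sum => j _.
by rewrite !mxE enormZ [c j * _]mulrC -mulrA ler_wpM2l.
Qed.

Lemma dotp_posvec m (v : 'cV[R]_m) :
  dotp (posvec v) v = enorm (posvec v) ^+ 2.
Proof.
rewrite enorm_sqr; apply: eq_bigr => j _; rewrite !mxE.
by case: (ler0P (v j 0)); rewrite ?mul0r ?mulr0.
Qed.

Lemma dotp_le_posvec m (l v : 'cV[R]_m) : nneg_orthant l ->
  dotp l v <= enorm l * enorm (posvec v).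
Proof.
move=> l0; apply: le_trans (cauchy_schwarz _ _); apply: ler_sum => j _.
by rewrite ler_wpM2l ?l0 // mxE le_max lexx.
Qed.

(** * Convexity and the proximal step *)

(** Convexity along a segment with a real parameter, so that the parameter can be
    sent to zero without carrying a proof that it lies in the unit interval. *)
Definition segment_closed n (A : set 'cV[R]_n) :=
  forall a b h, A a -> A b -> 0 <= h -> h <= 1 -> A (a + h *: (b - a)).

Lemma segmentE n (a b : 'cV[R]_n) (h : R) :
  a + h *: (b - a) = h *: b + (1 - h) *: a.
Proof. by rewrite scalerBr scalerBl scale1r addrC -addrA (addrC a). Qed.

Lemma convex_set_segment n (A : set 'cV[R]_n) :
  convex_set A -> segment_closed A.
Proof.
move=> cA a b h Aa Ab h0 h1.
have hh : Itv.spec (@Itv.num_sem R) (Itv.Real `[0%Z, 1%Z]) h.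
  by rewrite /= /Itv.num_sem /= in_itv /= h0 h1 num_real.
have := cA b a (Itv.mk hh); rewrite !inE => /(_ Ab Aa).
by rewrite segmentE.
Qed.

Lemma convex_function_segment n (A : set 'cV[R]_n) (f : 'cV[R]_n -> R) a b h :
  convex_function A f -> A a -> A b -> 0 <= h -> h <= 1 ->
  f (a + h *: (b - a)) <= f a + h * (f b - f a).
Proof.
move=> cf Aa Ab h0 h1.
have hh : Itv.spec (@Itv.num_sem R) (Itv.Real `[0%Z, 1%Z]) h.
  by rewrite /= /Itv.num_sem /= in_itv /= h0 h1 num_real.
have := cf (Itv.mk hh) b a; rewrite !inE => /(_ Ab Aa) H.
rewrite segmentE; apply: le_trans H _.
by rewrite convRE /= /unstable.onem; lra.
Qed.

Lemma nneg_orthant_segment m : segment_closed (@nneg_orthant R m).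
Proof.
move=> a b h a0 b0 h0 h1 j; rewrite !mxE.
have := mulr_ge0 h0 (b0 j); have h1' : 0 <= 1 - h by rewrite subr_ge0.
have := mulr_ge0 h1' (a0 j); lra.
Qed.

Lemma ge0_of_segment (p q : R) :
  (forall h, 0 < h -> h <= 1 -> 0 <= h * p + h ^+ 2 * q) -> 0 <= p.
Proof.
move=> H; apply/ler_addgt0Pl => e e0.
(* A step of length at most e / (|q| + 1) makes the quadratic term cost at most
   e per unit of h. *)
have k0 : 0 < `|q| + 1 by rewrite ltr_wpDl.
have q1 : q <= `|q| by exact: ler_norm.
pose h := Num.min 1 (e / (`|q| + 1)).
have h0 : 0 < h by rewrite lt_min ltr01 divr_gt0.
have h1 : h <= 1 by rewrite ge_min lexx.
have : 0 <= p + h * q.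
  by rewrite -(pmulr_rge0 _ h0) mulrDr mulrA -expr2; exact: H.
have : h * (`|q| + 1) <= e by rewrite -ler_pdivlMr // ge_min lexx orbT.
have := ler_wpM2l (ltW h0) q1; lra.
Qed.

(** First-order optimality of [a] along the segment to [b], combined with the
    polarization identity for the triangle [a], [b], [z]. *)
Lemma argmin_prox_le n (A : set 'cV[R]_n) (u z a b : 'cV[R]_n) (e : R) :
  segment_closed A ->
  argmin A (fun y => dotp u y + e / 2 * enorm (y - z) ^+ 2) a -> A b ->
  dotp u (a - b) <=
    e / 2 * (enorm (b - z) ^+ 2 - enorm (b - a) ^+ 2 - enorm (a - z) ^+ 2).
Proof.
move=> sA [Aa amin] Ab.
have bz : b - z = (b - a) + (a - z) by rewrite addrA subrK.
have : 0 <= dotp u (b - a) + e * dotp (a - z) (b - a).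
  apply: (@ge0_of_segment _ (e / 2 * dotp (b - a) (b - a))) => h h0 h1.
  have := amin _ (sA _ _ _ Aa Ab (ltW h0) h1).
  have -> : a + h *: (b - a) - z = (a - z) + h *: (b - a) by rewrite addrAC.
  move: (b - a) (a - z) => d c.
  by rewrite !enorm_sqr !(dotpDl, dotpDr) !(dotpZl, dotpZr) (dotpC d c); lra.
rewrite bz -[a - b]opprB dotpNr !enorm_sqr.
move: (b - a) (a - z) => d c.
by rewrite dotpDl !dotpDr (dotpC d c); lra.
Qed.

(** The gradient is only known relative to [A], possibly with empty interior, so
    the difference quotients are taken along the segment from [a] to [b]:
    convexity bounds each of them by [f b - f a], and they tend to
    [dotp v (b - a)]. *)
Lemma convex_gradient_le n (A : set 'cV[R]_n) (f : 'cV[R]_n -> R)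
    (a b v : 'cV[R]_n) :
  convex_set A -> convex_function A f -> is_gradient_on A f a v ->
  A a -> A b -> dotp v (b - a) <= f b - f a.
Proof.
move=> /convex_set_segment sA cf gf Aa Ab.
apply/ler_addgt0Pl => e e0.
(* Adding 1 to the length avoids a separate case [a = b]. *)
have k0 : 0 < enorm (b - a) + 1 by rewrite ltr_wpDl ?enorm_ge0.
have /eqoP /(_ (e / (enorm (b - a) + 1))) := gf.
rewrite divr_gt0 // => /(_ isT); rewrite /within /= => near_a.
have cvgh : (fun h : R => a + h *: (b - a)) @ (0 : R) --> a.
  rewrite -[X in _ --> X](_ : a + 0 *: (b - a) = a); last by rewrite scale0r addr0.
  apply: cvgD; first exact: cvg_cst.
  exact: scalel_continuous.
have /nbhs_ballP [r /= r0 hr] := cvgh _ near_a.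
pose h := Num.min 1 (r / 2).
have h0 : 0 < h by rewrite lt_min ltr01 divr_gt0.
have h1 : h <= 1 by rewrite ge_min lexx.
have hlt : h < r by rewrite gt_min ltr_pdivrMr // ltr_pMr // ltr1n orbT.
have /= := hr h; rewrite /ball /= sub0r normrN gtr0_norm // => /(_ hlt).
move=> /(_ (sA _ _ _ Aa Ab (ltW h0) h1)).
rewrite [a + _ - a]addrC addKr enormZ dotpZr (gtr0_norm h0).
rewrite [`|h * _|]ger0_norm ?mulr_ge0 ?enorm_ge0 ?(ltW h0) //.
have := convex_function_segment cf Aa Ab (ltW h0) h1.
set fh := f (a + _) => fh_le; rewrite ler_norml => /andP[fh_ge _].
rewrite -(ler_pM2l h0).
have : e / (enorm (b - a) + 1) * (h * enorm (b - a)) <= h * e.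
  rewrite mulrCA ler_pM2l // -mulrA ger_pMr // mulrC ler_pdivrMr // mul1r.
  by rewrite lerDl.
lra.
Qed.

(** Membership and the inequality are proved in one induction because the
    inductive step needs the previous average to lie in [A]; the average is
    extended by moving towards the new point by the fraction [c / (s + c)]. *)
Lemma convex_jensen n (A : set 'cV[R]_n) (f : 'cV[R]_n -> R) (w : nat -> R)
    (p : nat -> 'cV[R]_n) (T : nat) :
  convex_set A -> convex_function A f ->
  (forall t, 0 < w t) -> (forall t, A (p t)) ->
  A ((\sum_(t < T.+1) w t)^-1 *: \sum_(t < T.+1) w t *: p t) /\
  (\sum_(t < T.+1) w t) *
     f ((\sum_(t < T.+1) w t)^-1 *: \sum_(t < T.+1) w t *: p t)
   <= \sum_(t < T.+1) w t * f (p t).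
Proof.
move=> cA cf w0 Ap; elim: T => [|T [IA If]].
  rewrite !big_ord_recl !big_ord0 !addr0 scalerA mulVf ?gt_eqF // scale1r.
  by split.
have s0 : 0 < \sum_(t < T.+1) w t.
  by rewrite big_ord_recl ltr_pwDl // sumr_ge0 // => i _; exact: ltW.
rewrite !(big_ord_recr T.+1) /=.
set s := \sum_(t < T.+1) w t in s0 IA If *.
set q := \sum_(t < T.+1) w t *: p t in IA If *.
set c := w T.+1; have c0 : 0 < c by exact: w0.
have sc : 0 < s + c by rewrite addr_gt0.
pose h := c / (s + c).
have h0 : 0 <= h by rewrite divr_ge0 ?ltW.
have h1 : h <= 1 by rewrite ler_pdivrMr // mul1r lerDr ltW.
have -> : (s + c)^-1 *: (q + c *: p T.+1) =
    s^-1 *: q + h *: (p T.+1 - s^-1 *: q).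
  apply/matrixP => i j; rewrite !mxE /h; field.
  by rewrite !gt_eqF.
split; first exact: convex_set_segment.
have := convex_function_segment cf IA (Ap T.+1) h0 h1.
rewrite -(ler_pM2l sc) => /le_trans; apply.
have -> : (s + c) * (f (s^-1 *: q) + h * (f (p T.+1) - f (s^-1 *: q))) =
    s * f (s^-1 *: q) + c * f (p T.+1).
  by rewrite /h; field; rewrite gt_eqF.
by rewrite lerD2r.
Qed.

End EuclideanTheory.

(** * Constraint maps and step parameters *)

(** In the variables [a] and [sqrt beta * b] the bilinear form on the left is [e]
    times the matrix with rows [(1/3, 1/sqrt 12)] and [(1/sqrt 12, 0)], whose
    eigenvalues are [1/2] and [-1/6]; its norm is therefore [1/2]. *)
Lemma coupling_form_le {R : realFieldType} (e M beta a b c d : R) :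
  0 < e -> M ^+ 2 = beta * e ^+ 2 / 12 ->
  e / 3 * a * c + M * (b * c + a * d) <=
    e / 4 * (a ^+ 2 + beta * b ^+ 2 + (c ^+ 2 + beta * d ^+ 2)).
Proof.
move=> e0 M2; have en0 : e != 0 by rewrite gt_eqF.
(* With M = r e the weight beta is 12 r^2, so no square root of beta is needed. *)
pose r := M / e.
have -> : M = r * e by rewrite /r mulfVK.
have -> : beta = 12 * r ^+ 2 by rewrite /r expr_div_n M2; field.
(* Sum of squares along the two eigenvectors; the negative eigenvalue is what
   produces the last square. *)
rewrite -subr_ge0.
have -> : e / 4 * (a ^+ 2 + 12 * r ^+ 2 * b ^+ 2 + (c ^+ 2 + 12 * r ^+ 2 * d ^+ 2))
    - (e / 3 * a * c + r * e * (b * c + a * d)) =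
  e * (3 / 16 * (a + 2 * (r * b) - c - 2 * (r * d)) ^+ 2
       + 1 / 24 * ((a - 6 * (r * b)) ^+ 2 + (c - 6 * (r * d)) ^+ 2)
       + 1 / 48 * (a - 6 * (r * b) + c - 6 * (r * d)) ^+ 2) by field.
apply: mulr_ge0 (ltW e0) _.
by do ![exact: sqr_ge0 | apply: addr_ge0 | apply: mulr_ge0 | lra].
Qed.

Section Constraints.
Context {R : realType} {n m : nat}.
Variables (X : set 'cV[R]_n) (F : 'cV[R]_n -> 'cV[R]_n).
Variables (g : 'I_m -> 'cV[R]_n -> R) (dg : 'I_m -> 'cV[R]_n -> 'cV[R]_n).
Variables (L : R) (Mgj Lgj : 'I_m -> R).
Hypothesis pb : smooth_fcvi X F g dg L Mgj Lgj.

Lemma gradmx_mul a (l : 'cV[R]_m) : gradmx dg a *m l = \sum_j l j 0 *: dg j a.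
Proof.
apply/matrixP => i k; rewrite ord1 !mxE summxE.
by apply: eq_bigr => j _; rewrite !mxE mulrC.
Qed.

Lemma gvec_lipschitz a b : X a -> X b ->
  enorm (gvec g a - gvec g b) <= l2norm Mgj * enorm (a - b).
Proof.
move=> Xa Xb; apply: enorm_le_l2norm => [|j]; first exact: enorm_ge0.
by rewrite !mxE; exact: fcvi_lipschitz_g pb _ _ _ _ _.
Qed.

(** Changing the point first and the multiplier second lets the constant involve
    only the multiplier [k] at the older point, which is known when the step size
    is chosen. *)
Lemma lagrangian_lipschitz a b (l k : 'cV[R]_m) : X a -> X b ->
  enorm ((F a + gradmx dg a *m l) - (F b + gradmx dg b *m k)) <=
    (L + l2norm Lgj * enorm k) * enorm (a - b) + l2norm Mgj * enorm (l - k).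
Proof.
move=> Xa Xb.
have -> : (F a + gradmx dg a *m l) - (F b + gradmx dg b *m k) =
    (F a - F b) + \sum_j k j 0 *: (dg j a - dg j b)
    + \sum_j (l - k) j 0 *: dg j a.
  rewrite !gradmx_mul opprD addrACA -[RHS]addrA; congr (_ + _).
  rewrite -sumrN -!big_split; apply: eq_bigr => j _ /=.
  by apply/matrixP => i z; rewrite !mxE; ring.
apply: le_trans (enormD _ _) _; apply: lerD; last first.
  have := @enorm_lincomb R m n (l - k) (dg^~ a) Mgj 1 ler01.
  rewrite mulr1; apply => j; rewrite mulr1; exact: fcvi_bound_dg pb _ _ _.
apply: le_trans (enormD _ _) _; rewrite mulrDl; apply: lerD.
  exact: fcvi_lipschitz_F pb _ _ _ _.
apply: enorm_lincomb => [|j]; first exact: enorm_ge0.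
exact: fcvi_lipschitz_dg pb _ _ _ _ _.
Qed.

(** The gradient inequality for each [g j], weighted by the multipliers. *)
Lemma dotp_gradmx_le (l : 'cV[R]_m) a b : nneg_orthant l -> X a -> X b ->
  dotp (gradmx dg a *m l) (b - a) <= dotp l (gvec g b) - dotp l (gvec g a).
Proof.
move=> l0 Xa Xb; rewrite -dotpBr gradmx_mul dotp_suml; apply: ler_sum => j _.
rewrite dotpZl !mxE ler_wpM2l ?l0 //.
by apply: (convex_gradient_le (fcvi_convex_X pb) (fcvi_convex_g pb _)
  (fcvi_gradient pb _ Xa)).
Qed.

(** The function [y |-> <F xs, y - xs> + <ls, g y>] is convex, stationary at [xs]
    relative to [X], and vanishes there by complementary slackness. *)
Lemma kkt_ge0 (xs : 'cV[R]_n) (ls : 'cV[R]_m) y :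
  X xs -> kkt_multiplier X F g dg xs ls -> X y ->
  0 <= dotp (F xs) (y - xs) + dotp ls (gvec g y).
Proof.
move=> Xxs [ls0 [v nv eq0] cs] Xy.
have compl : dotp ls (gvec g xs) = 0.
  by apply: big1 => j _; rewrite mxE cs.
have := dotp_gradmx_le ls0 Xxs Xy; rewrite compl subr0 gradmx_mul.
have := nv _ Xy; have := congr1 (fun z => dotp z (y - xs)) eq0.
rewrite dotp0l !dotpDl; lra.
Qed.

End Constraints.

Section StepSizes.
Context {R : realType} {m : nat}.
Variables (c1 c2 L Lg : R) (lam : nat -> 'cV[R]_m).
Hypotheses (c1_gt0 : 0 < c1) (c2_gt0 : 0 < c2) (L_gt0 : 0 < L) (Lg_ge0 : 0 <= Lg).
Local Notation eta := (eta_param c1 c2 L Lg lam).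
Local Notation gamma := (gamma_param eta).

Lemma eta0E : eta 0%N = c1 * L.
Proof. by rewrite /eta_param big_geq // mulr0 addr0. Qed.

Lemma eta_ge t : c1 * L <= eta t.
Proof.
by rewrite lerDl !mulr_ge0 ?(ltW c2_gt0) // bigmax_ge_id.
Qed.

Lemma eta_gt0 t : 0 < eta t.
Proof. by apply: lt_le_trans (eta_ge t); rewrite mulr_gt0. Qed.

Lemma enorm_lam_le_eta t : lam 0%N = 0 ->
  c1 * L + c2 * Lg * enorm (lam t) <= eta t.
Proof.
move=> lam0; rewrite lerD2l ler_wpM2l ?mulr_ge0 ?(ltW c2_gt0) //.
case: t => [|t]; first by rewrite lam0 enorm0 big_geq.
by apply: (bigmax_sup_seq _ t.+1); rewrite ?mem_index_iota ?ltnSn.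
Qed.

Lemma eta_le_of_bound (B : R) t : 0 <= B -> (forall i, enorm (lam i.+1) <= B) ->
  eta t <= c1 * L + c2 * Lg * B.
Proof.
move=> B0 hB; rewrite lerD2l ler_wpM2l ?mulr_ge0 ?(ltW c2_gt0) //.
by rewrite big_add1; apply: bigmax_le.
Qed.

Lemma gamma_gt0 t : 0 < gamma t.
Proof. by rewrite divr_gt0 ?eta_gt0. Qed.

Lemma gamma_le1 t : gamma t <= 1.
Proof. by rewrite ler_pdivrMr ?eta_gt0 // mul1r eta0E eta_ge. Qed.

Lemma gamma_eta t : gamma t * eta t = c1 * L.
Proof. by rewrite /gamma_param mulfVK ?gt_eqF ?eta_gt0 // eta0E. Qed.

Lemma Gamma_gt0 T : (0 < T)%N -> 0 < Gamma_sum gamma T.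
Proof.
case: T => // T _; rewrite /Gamma_sum big_ord_recl ltr_pwDl ?gamma_gt0 //.
by apply: sumr_ge0 => i _; exact: ltW (gamma_gt0 _).
Qed.

(** From [c1 L <= eta t] and [c2 Lg |lam t| <= eta t - c1 L] one gets
    [L + Lg |lam t| <= (1/c1 + 1/c2) * eta t], and the condition on [c1] and [c2]
    says that the factor is at most [1/3]. *)
Lemma gamma_lipschitz t : lam 0%N = 0 -> c1 / c2 + 1 <= c1 / 3 ->
  gamma t * (L + Lg * enorm (lam t)) <= c1 * L / 3.
Proof.
move=> lam0 c12; rewrite -(gamma_eta t) -mulrA ler_pM2l ?gamma_gt0 //.
have := enorm_lam_le_eta t lam0; have := eta_ge t.
set h := eta t; set a := enorm _ => h1 h2.
have c12' : c2^-1 + c1^-1 <= 3^-1.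
  rewrite -(ler_pM2l c1_gt0) mulrDr divff ?gt_eqF //.
have : Lg * a <= (h - c1 * L) / c2 by rewrite ler_pdivlMr //; lra.
have h0 : 0 <= h by apply: le_trans h1; rewrite ltW // mulr_gt0.
have : L <= h / c1 by rewrite ler_pdivlMr //; lra.
have := ler_wpM2l h0 c12'.
have : 0 <= c1 * L / c2 by rewrite ltW // divr_gt0 // mulr_gt0.
lra.
Qed.

End StepSizes.

(** * The telescoping estimate *)

Lemma le_sqrt_sum {R : rcfType} (p q a b d : R) :
  0 <= p -> 0 <= q -> 0 <= a -> 0 <= b -> 0 <= d ->
  d ^+ 2 <= p * a ^+ 2 + q * b ^+ 2 -> d <= Num.sqrt p * a + Num.sqrt q * b.
Proof.
move=> p0 q0 a0 b0 d0 hd.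
rewrite -(ler_pXn2r (ltn0Sn 1)) ?nnegrE ?addr_ge0 ?mulr_ge0 ?sqrtr_ge0 //.
rewrite sqrrD !exprMn !sqr_sqrtr //.
have : 0 <= Num.sqrt p * a * (Num.sqrt q * b) by rewrite !mulr_ge0 ?sqrtr_ge0.
lra.
Qed.

(** An extrapolated operator, multiplied by its weight, is the operator at the
    next iterate plus increments that telescope, up to a pairing of the last
    increment with the last step. *)
Lemma extrapolation_split {R : realType} {k : nat} (c th : R)
    (h2 h1 h0 p2 p1 y : 'cV[R]_k) :
  c * dotp ((1 + th) *: h1 - th *: h0) (p2 - y) =
    c * dotp h2 (p2 - y) - c * dotp (h2 - h1) (p2 - y)
    + c * th * (dotp (h1 - h0) (p1 - y) + dotp (h1 - h0) (p2 - p1)).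
Proof. by rewrite !(dotpBl, dotpBr) !(dotpZl, dotpZr); ring. Qed.

Section OperatorExtrapolation.
Context {R : realType} {n m : nat}.
Variables (X : set 'cV[R]_n) (F : 'cV[R]_n -> 'cV[R]_n).
Variables (g : 'I_m -> 'cV[R]_n -> R) (dg : 'I_m -> 'cV[R]_n -> 'cV[R]_n).
Variables (L : R) (Mgj Lgj : 'I_m -> R) (c1 c2 beta gm1 : R).
Variables (x : nat -> 'cV[R]_n) (lam : nat -> 'cV[R]_m).
Local Notation Mg := (l2norm Mgj).
Local Notation Lg := (l2norm Lgj).
Local Notation eta := (eta_param c1 c2 L Lg lam).
Local Notation gamma := (gamma_param eta).
Local Notation theta := (theta_param gm1 gamma).
Local Notation tau := (fun t => beta * eta t).
Hypothesis pb : smooth_fcvi X F g dg L Mgj Lgj.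
Hypotheses (c1_gt0 : 0 < c1) (c2_gt0 : 0 < c2) (beta_gt0 : 0 < beta).
Hypothesis c1c2 : c1 / c2 + 1 <= c1 / 3.
Hypothesis betaE : beta = 12 * Mg ^+ 2 / (c1 ^+ 2 * L ^+ 2).
Hypothesis opex : adaptive_opex X F g dg eta theta tau x lam.

Local Notation e := (c1 * L).

Let L_gt0 : 0 < L := fcvi_L_gt0 pb.
Let e_gt0 : 0 < e. Proof. exact: mulr_gt0. Qed.
Let lam0 : lam 0%N = 0 := opex_lam0 opex.

Lemma opex_iterate_in t : X (x t).
Proof. by case: t => [|t]; [exact: opex_x0 opex|have [] := opex_x opex t]. Qed.

Lemma opex_multiplier_ge0 t : nneg_orthant (lam t).
Proof.
case: t => [|t]; first by move=> j; rewrite lam0 mxE.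
by have [] := opex_lam opex t.
Qed.

Definition lagrangian_op t := F (x t) + gradmx dg (x t) *m lam t.

(** Pairing of the last increment of the saddle operator
    [(x, l) |-> (F x + grad g(x) l, - g x)] with a direction [(p, q)]. *)
Definition coupling t (p : 'cV[R]_n) (q : 'cV[R]_m) :=
  dotp (lagrangian_op t - lagrangian_op t.-1) p
  - dotp (gvec g (x t) - gvec g (x t.-1)) q.

Definition sqdist (p : 'cV[R]_n) (q : 'cV[R]_m) :=
  enorm p ^+ 2 + beta * enorm q ^+ 2.

(** Saddle gap of the iterate [t.+1] against [(y, l)], with [F] evaluated at the
    comparison point as in the weak form of the variational inequality. *)
Definition gap t (y : 'cV[R]_n) (l : 'cV[R]_m) :=
  dotp (F y) (x t.+1 - y) + dotp l (gvec g (x t.+1))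
  - dotp (lam t.+1) (gvec g y).

Definition gamma_prev t := if t is s.+1 then gamma s else gm1.

Lemma sqdist_ge0 p q : 0 <= sqdist p q.
Proof. by rewrite addr_ge0 ?sqr_ge0 // mulr_ge0 ?sqr_ge0 // ltW. Qed.

Lemma gamma_theta t : gamma t * theta t = gamma_prev t.
Proof.
by rewrite /theta_param mulrC mulfVK // gt_eqF // gamma_gt0 // l2norm_ge0.
Qed.

Lemma coupling0 p q : coupling 0%N p q = 0.
Proof. by rewrite /coupling /= !subrr !dotp0l subrr. Qed.

Lemma couplingN t p q : coupling t (- p) (- q) = - coupling t p q.
Proof. by rewrite /coupling !dotpNr; lra. Qed.

(** The weight [gamma t] turns the Lipschitz constant of the Lagrangian operator
    into at most [e / 3] and leaves [Mg] at most itself, which are the entries of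
    the form in [coupling_form_le].  At [t = 0] the increment vanishes, so the
    arbitrary weight [gm1] is harmless. *)
Lemma gamma_coupling_le t p q :
  gamma_prev t * coupling t p q <=
    e / 4 * (sqdist (x t - x t.-1) (lam t - lam t.-1) + sqdist p q).
Proof.
case: t => [|t].
  rewrite coupling0 mulr0; apply: mulr_ge0; first by rewrite ltW // divr_gt0.
  by rewrite addr_ge0 ?sqdist_ge0.
rewrite /coupling /=.
have g0 : 0 < gamma t by rewrite gamma_gt0 // l2norm_ge0.
have g1 : gamma t <= 1 by rewrite gamma_le1 // l2norm_ge0.
have Xt := opex_iterate_in t; have Xt1 := opex_iterate_in t.+1.
have hH := lagrangian_lipschitz pb (lam t.+1) (lam t) Xt1 Xt.
have hG := gvec_lipschitz pb Xt1 Xt.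
have hL := @gamma_lipschitz _ _ _ _ _ _ _ c1_gt0 c2_gt0 L_gt0
  (l2norm_ge0 Lgj) t lam0 c1c2.
have hp := cauchy_schwarz (lagrangian_op t.+1 - lagrangian_op t) p.
have hq := cauchy_schwarz (gvec g (x t.+1) - gvec g (x t)) (- q).
rewrite dotpNr enormN in hq.
have p0 := enorm_ge0 p; have q0 := enorm_ge0 q.
have M2 : Mg ^+ 2 = beta * e ^+ 2 / 12.
  rewrite betaE; field.
  by rewrite !gt_eqF.
apply: le_trans (coupling_form_le _ _ _ _ e_gt0 M2).
have a0 := enorm_ge0 (x t.+1 - x t); have b0 := enorm_ge0 (lam t.+1 - lam t).
have M0 := l2norm_ge0 Mgj.
move: hH hG hL hp hq p0 q0 a0 b0.
rewrite -/(lagrangian_op _) -/(lagrangian_op _).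
move: (enorm (x t.+1 - x t)) (enorm (lam t.+1 - lam t)) (enorm p) (enorm q).
move=> a b c d hH hG hL hp hq p0 q0 a0 b0.
have h1 := ler_wpM2r p0 hH.
have h2 := ler_wpM2r q0 hG.
have h3 := ler_wpM2r (mulr_ge0 a0 p0) hL.
have h4 : gamma t * (Mg * (b * c + a * d)) <= Mg * (b * c + a * d).
  by rewrite ler_piMl // mulr_ge0 // addr_ge0 ?mulr_ge0.
have h5 : dotp (lagrangian_op t.+1 - lagrangian_op t) p
    - dotp (gvec g (x t.+1) - gvec g (x t)) q <=
    (L + Lg * enorm (lam t)) * (a * c) + Mg * (b * c + a * d) by lra.
have := ler_wpM2l (ltW g0) h5; lra.
Qed.

(** Minus the remaining distance to [(y, l)], corrected by the coupling still to
    be telescoped and by the half of the last proximal term reserved for the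
    coupling of the next step. *)
Definition potential t (y : 'cV[R]_n) (l : 'cV[R]_m) :=
  gamma_prev t * coupling t (x t - y) (lam t - l)
  - e / 2 * sqdist (y - x t) (l - lam t)
  - e / 4 * sqdist (x t - x t.-1) (lam t - lam t.-1).

(** Monotonicity moves [F] from the comparison point to the iterate, and the
    gradient inequality linearizes the constraints. *)
Lemma gap_le_lagrangian t y l : X y ->
  gap t y l <= dotp (lagrangian_op t.+1) (x t.+1 - y)
               - dotp (gvec g (x t.+1)) (lam t.+1 - l).
Proof.
move=> Xy; have Xt := opex_iterate_in t.+1.
have := fcvi_monotone pb Xt Xy.
have := dotp_gradmx_le pb (opex_multiplier_ge0 t.+1) Xt Xy.
rewrite /gap /lagrangian_op dotpBl dotpDl -(opprB y) !dotpNr.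
rewrite !(dotpC (gvec g _)) !dotpBl; lra.
Qed.

Lemma gap_le_potential t y l : X y -> nneg_orthant l ->
  gamma t * gap t y l <= potential t.+1 y l - potential t y l.
Proof.
move=> Xy l0.
have hx := argmin_prox_le (convex_set_segment (fcvi_convex_X pb))
  (opex_x opex t) Xy.
have hl := argmin_prox_le (@nneg_orthant_segment R m) (opex_lam opex t) l0.
have g0 : 0 < gamma t by rewrite gamma_gt0 // l2norm_ge0.
have hg := ler_wpM2l (ltW g0) (gap_le_lagrangian t l Xy).
(* The coupling with the step just made enters with a minus sign, hence the
   opposite direction. *)
have hc := gamma_coupling_le t (- (x t.+1 - x t)) (- (lam t.+1 - lam t)).
rewrite couplingN /sqdist !enormN in hc.
have ge : gamma t * eta t = e by apply: gamma_eta => //; exact: l2norm_ge0.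
have prox (z : R) : gamma t * (eta t / 2 * z) = e / 2 * z.
  by rewrite -ge; ring.
have proxb (z : R) : gamma t * (beta * eta t / 2 * z) = beta * (e / 2 * z).
  by rewrite -ge; ring.
have := ler_wpM2l (ltW g0) hx; have := ler_wpM2l (ltW g0) hl.
rewrite prox proxb dotpNl mulrN.
rewrite (extrapolation_split _ _ (lagrangian_op t.+1) _ _ _ (x t)).
rewrite (extrapolation_split _ _ (gvec g (x t.+1)) _ _ _ (lam t)) gamma_theta.
move: hc hg; rewrite /potential /coupling /sqdist /= -!/(lagrangian_op _).
lra.
Qed.

(** The final coupling, between the last increment and the distance to [(y, l)],
    uses up half of the final distance term: this is why [e / 2] at the start
    becomes [e / 4] at the end. *)
Lemma sum_gap_le T y l : X y -> nneg_orthant l ->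
  \sum_(t < T) gamma t * gap t y l <=
    e / 2 * sqdist (y - x 0%N) l - e / 4 * sqdist (y - x T) (l - lam T).
Proof.
move=> Xy l0.
have tele :
    \sum_(t < T) gamma t * gap t y l <= potential T y l - potential 0 y l.
  elim: T => [|T IH]; first by rewrite big_ord0 subrr.
  rewrite big_ord_recr /=; have := gap_le_potential T Xy l0; lra.
have := gamma_coupling_le T (x T - y) (lam T - l).
move: tele; rewrite /potential coupling0 /= /sqdist !subrr !enorm0 lam0 subr0.
rewrite (enormBC (x T) y) (enormBC (lam T) l) expr0n /=; lra.
Qed.

(** * Consequences for the multipliers and the averaged iterate *)

Lemma feasible_multiplier_term_le0 t y :
  feasible X g y -> dotp (lam t) (gvec g y) <= 0.
Proof.
move=> [_ gy]; apply: sumr_le0 => j _.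
by rewrite mxE mulr_ge0_le0 // opex_multiplier_ge0.
Qed.

(** At a saddle point all gaps are nonnegative, so the telescoping estimate
    bounds the distance from each multiplier to the optimal one. *)
Lemma multiplier_bound xs ls t :
  feasible X g xs -> kkt_multiplier X F g dg xs ls ->
  enorm (lam t) <=
    Num.sqrt (2 / beta) * enorm (x 0%N - xs) + (Num.sqrt 2 + 1) * enorm ls.
Proof.
move=> fxs kkt; have [Xxs _] := fxs; have [ls0 _ _] := kkt.
have gaps : 0 <= \sum_(i < t) gamma i * gap i xs ls.
  apply: sumr_ge0 => i _; rewrite mulr_ge0 //.
    by rewrite ltW // gamma_gt0 // l2norm_ge0.
  have := kkt_ge0 pb Xxs kkt (opex_iterate_in i.+1).
  have := feasible_multiplier_term_le0 i.+1 fxs; rewrite /gap; lra.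
have : e * (beta * enorm (ls - lam t) ^+ 2) <=
    e * (2 * enorm (xs - x 0%N) ^+ 2 + 2 * beta * enorm ls ^+ 2).
  have := sum_gap_le t Xxs ls0.
  have := mulr_ge0 (ltW e_gt0) (sqr_ge0 (enorm (xs - x t))).
  rewrite /sqdist; lra.
rewrite ler_pM2l // (enormBC xs) => dist.
have -> : lam t = ls - (ls - lam t) by rewrite subKr.
apply: le_trans (enormD _ _) _; rewrite enormN.
suff : enorm (ls - lam t) <=
    Num.sqrt (2 / beta) * enorm (x 0%N - xs) + Num.sqrt 2 * enorm ls by lra.
apply: le_sqrt_sum; rewrite ?divr_ge0 ?enorm_ge0 ?(ltW beta_gt0) //.
rewrite -(ler_pM2l beta_gt0); apply: le_trans dist _.
by rewrite le_eqVlt; apply/orP; left; apply/eqP; field; rewrite gt_eqF.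
Qed.

Lemma xbar_in T : (0 < T)%N -> X (xbar gamma x T).
Proof.
case: T => // T _.
(* Only membership of the average is wanted: any convex function will do. *)
have [] := @convex_jensen R n X (fun=> 0) gamma (fun t => x t.+1) T
  (fcvi_convex_X pb) => //.
- by move=> t y z _ _; rewrite convRE !mulr0 addr0.
- by move=> t; rewrite gamma_gt0 // l2norm_ge0.
- by move=> t; exact: opex_iterate_in.
Qed.

Lemma Gamma_g_xbar_le T j : (0 < T)%N ->
  Gamma_sum gamma T * g j (xbar gamma x T) <=
    \sum_(t < T) gamma t * g j (x t.+1).
Proof.
case: T => // T _.
have [] := @convex_jensen R n X (g j) gamma (fun t => x t.+1) T
  (fcvi_convex_X pb) (fcvi_convex_g pb j) => //.
- by move=> t; rewrite gamma_gt0 // l2norm_ge0.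
- by move=> t; exact: opex_iterate_in.
Qed.

Lemma Gamma_dotp_xbar T (u y : 'cV[R]_n) : (0 < T)%N ->
  Gamma_sum gamma T * dotp u (xbar gamma x T - y) =
    \sum_(t < T) gamma t * dotp u (x t.+1 - y).
Proof.
move=> T0; have G0 : Gamma_sum gamma T != 0.
  by rewrite gt_eqF // Gamma_gt0 // l2norm_ge0.
rewrite dotpBr mulrBr /xbar dotpZr mulVKf // dotpC dotp_suml mulr_suml -sumrB.
by apply: eq_bigr => t _; rewrite dotpZl dotpC dotpBr mulrBr.
Qed.

(** Jensen's inequality needs [l >= 0] to pass to the average in the constraint
    term; the term in [lam] has a sign because [y] is feasible. *)
Lemma xbar_gap_le T y l : (0 < T)%N -> feasible X g y -> nneg_orthant l ->
  Gamma_sum gamma T *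
      (dotp (F y) (xbar gamma x T - y) + dotp l (gvec g (xbar gamma x T)))
    <= e / 2 * sqdist (y - x 0%N) l.
Proof.
move=> T0 fy l0; have [Xy _] := fy.
have := sum_gap_le T Xy l0.
have := mulr_ge0 (ltW e_gt0) (sqdist_ge0 (y - x T) (l - lam T)).
suff : Gamma_sum gamma T *
    (dotp (F y) (xbar gamma x T - y) + dotp l (gvec g (xbar gamma x T)))
    <= \sum_(t < T) gamma t * gap t y l by lra.
rewrite mulrDr Gamma_dotp_xbar //.
have gl : Gamma_sum gamma T * dotp l (gvec g (xbar gamma x T)) <=
    \sum_(t < T) gamma t * dotp l (gvec g (x t.+1)).
  under [leRHS]eq_bigr do rewrite mulr_sumr.
  rewrite exchange_big mulr_sumr; apply: ler_sum => j _ /=.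
  under [leRHS]eq_bigr do rewrite mxE mulrCA.
  by rewrite -mulr_sumr mxE mulrCA ler_wpM2l ?l0 // Gamma_g_xbar_le.
apply: le_trans (lerD (lexx _) gl) _; rewrite -big_split; apply: ler_sum => t _ /=.
rewrite -mulrDr ler_wpM2l //; first by rewrite ltW // gamma_gt0 // l2norm_ge0.
by rewrite lerDl oppr_ge0 feasible_multiplier_term_le0.
Qed.

(** Testing the saddle gap with a multiple of the constraint violation whose
    norm exceeds [|ls|] by one: the KKT inequality absorbs [|ls|] times the violation,
    and one copy of it remains. *)
Lemma xbar_violation_le xs ls T : (0 < T)%N ->
  feasible X g xs -> kkt_multiplier X F g dg xs ls ->
  Gamma_sum gamma T * enorm (posvec (gvec g (xbar gamma x T))) <=
    e / 2 * (enorm (xs - x 0%N) ^+ 2 + beta * (enorm ls + 1) ^+ 2).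
Proof.
move=> T0 fxs kkt; have [Xxs _] := fxs; have [ls0 _ _] := kkt.
have := kkt_ge0 pb Xxs kkt (xbar_in T0).
have := dotp_le_posvec (gvec g (xbar gamma x T)) ls0.
have := dotp_posvec (gvec g (xbar gamma x T)).
have v0 : nneg_orthant (posvec (gvec g (xbar gamma x T))).
  by move=> j; rewrite mxE le_max lexx orbT.
set v := posvec _ in v0 *; set gx := gvec _ _ => vgx lsgx kkt_xbar.
have ls1 : 0 <= enorm ls + 1 by rewrite addr_ge0 ?enorm_ge0.
have [vz|vnz] := eqVneq (enorm v) 0.
  rewrite vz mulr0; apply: mulr_ge0; first by rewrite ltW // divr_gt0.
  by rewrite addr_ge0 ?sqr_ge0 // mulr_ge0 ?sqr_ge0 // ltW.
have k0 : 0 <= (enorm ls + 1) / enorm v by rewrite divr_ge0 ?enorm_ge0.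
have l0 : nneg_orthant (((enorm ls + 1) / enorm v) *: v).
  by move=> j; rewrite mxE mulr_ge0 // v0.
have := xbar_gap_le T0 fxs l0.
rewrite /sqdist enormZ ger0_norm // mulfVK // -/gx dotpZl vgx.
have -> : (enorm ls + 1) / enorm v * enorm v ^+ 2 = (enorm ls + 1) * enorm v.
  by field.
apply: le_trans; rewrite ler_pM2l; last by rewrite Gamma_gt0 // l2norm_ge0.
lra.
Qed.

End OperatorExtrapolation.
(** * The convergence rate *)

Theorem theorem1 (R : realType) (n m : nat)
    (X : set 'cV[R]_n) (F : 'cV[R]_n -> 'cV[R]_n)
    (g : 'I_m -> 'cV[R]_n -> R) (dg : 'I_m -> 'cV[R]_n -> 'cV[R]_n)
    (L : R) (Mgj Lgj : 'I_m -> R)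
    (xs : 'cV[R]_n) (ls : 'cV[R]_m)
    (c1 c2 beta gm1 : R)
    (x : nat -> 'cV[R]_n) (lam : nat -> 'cV[R]_m) :
  let Mg := l2norm Mgj in
  let Lg := l2norm Lgj in
  let eta := eta_param c1 c2 L Lg lam in
  let gamma := gamma_param eta in
  let theta := theta_param gm1 gamma in
  let tau := fun t => beta * eta t in
  let B := Num.sqrt (2 / beta) * enorm (x 0%N - xs)
           + (Num.sqrt 2 + 1) * enorm ls in
  smooth_fcvi X F g dg L Mgj Lgj ->
  fcvi_solution X F g xs ->
  kkt_multiplier X F g dg xs ls ->
  0 < c1 -> 0 < c2 -> 0 < beta ->
  c1 / 3 >= c1 / c2 + 1 ->
  beta = 12 * Mg ^+ 2 / (c1 ^+ 2 * L ^+ 2) ->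
  adaptive_opex X F g dg eta theta tau x lam ->
  (forall t, enorm (lam t.+1) <= B) /\
  (forall T, (0 < T)%N ->
    [/\ forall y, feasible X g y ->
          Gamma_sum gamma T * dotp (F y) (xbar gamma x T - y)
            <= c1 * L / 2 * enorm (y - x 0%N) ^+ 2,
        Gamma_sum gamma T * enorm (posvec (gvec g (xbar gamma x T)))
          <= c1 * L / 2 * enorm (xs - x 0%N) ^+ 2
             + beta * c1 * L / 2 * (enorm ls + 1) ^+ 2
      & Gamma_sum gamma T >= c1 * L / (c1 * L + c2 * Lg * B) * T%:R]).

Proof.
move=> Mg Lg eta gamma theta tau B pb [fxs _] kkt c1_gt0 c2_gt0 beta_gt0 c1c2.
move=> betaE opex.
have Lg0 : 0 <= Lg by exact: l2norm_ge0.
have L0 := fcvi_L_gt0 pb.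
have lam_le t : enorm (lam t) <= B.
  exact: (multiplier_bound pb c1_gt0 c2_gt0 beta_gt0 c1c2 betaE opex t fxs kkt).
have B0 : 0 <= B by apply: le_trans (lam_le 0%N); exact: enorm_ge0.
split=> [t|T T0]; first exact: lam_le.
split=> [y fy||].
- have l0 : nneg_orthant (0 : 'cV[R]_m) by move=> j; rewrite mxE.
  have := xbar_gap_le pb c1_gt0 c2_gt0 beta_gt0 c1c2 betaE opex T0 fy l0.
  by rewrite /sqdist dotp0l enorm0 expr0n mulr0 !addr0.
- have := xbar_violation_le pb c1_gt0 c2_gt0 beta_gt0 c1c2 betaE opex T0 fxs kkt.
  by move=> /le_trans; apply; lra.
- rewrite mulr_natr -[X in _ *+ X]card_ord -sumr_const; apply: ler_sum => t _.
  have cL0 : 0 < c1 * L by exact: mulr_gt0.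
  rewrite /gamma /gamma_param {1}/eta eta0E.
  apply: ler_wpM2l; first exact: ltW.
  rewrite lef_pV2 ?posrE ?eta_le_of_bound ?eta_gt0 //.
  by rewrite ltr_pwDl // !mulr_ge0 // ltW.
Qed.
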